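(* Let $h>0$ and let $\lambda_1\le\lambda_2\le\cdots$ be the Dirichlet eigenvalues of $\mathbb{S}^1\times I_h$. The inequalities $$\frac1k\sum_{i=1}^k\lambda_i\ \ge\ \frac{k}{h},\qquad k=1,2,\dots$$ hold for all $k$ if and only if $h\in(0,\pi^2]$.
   Context: $\mathbb{S}^1$ is the unit circle (of length $2\pi$) and $I_h$ is an open interval of length $h>0$; $\mathbb{S}^1\times I_h$ carries the flat product metric. The Dirichlet eigenvalues of $\mathbb{S}^1\times I_h$ are the numbers $m^2+n^2\pi^2/h^2$ with $(m,n)\in\mathbb{Z}\times\mathbb{N}$, $\mathbb{N}=\{1,2,\dots\}$, one for each pair $(m,n)$ (so counted with multiplicity), listed in non-decreasing order as $\lambda_1\le\lambda_2\le\cdots$. *)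

(* Defs.v *)
From mathcomp Require Import all_boot all_order all_algebra.
From mathcomp Require Import all_classical all_reals all_analysis.

Set Implicit Arguments.
Unset Strict Implicit.
Unset Printing Implicit Defensive.

Import Order.TTheory GRing.Theory Num.Theory.

Local Open Scope classical_set_scope.
Local Open Scope ring_scope.

(* For [p = (m, n)] with [n >= 1], the eigenvalue of the Dirichlet Laplacian on
   the cylinder S^1 x ]0, h[ (S^1 of length 2 pi) with eigenfunction
   e^(i m x) sin (n pi y / h). *)
Definition cylinder_eigenvalue (R : realType) (h : R) (p : int * nat) : R :=
  p.1%:~R ^+ 2 + p.2%:R ^+ 2 * pi ^+ 2 / h ^+ 2.

(* [lambda 1 <= lambda 2 <= ...] lists the Dirichlet eigenvalues with
   multiplicity: every pair (m, n) with [n >= 1] is used by exactly one index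
   [i >= 1]. The value [lambda 0] is unconstrained. *)
Definition dirichlet_spectrum (R : realType) (h : R) (lambda : nat -> R) : Prop :=
  (forall i j : nat, (0 < i)%N -> (i <= j)%N -> lambda i <= lambda j) /\
  exists e : nat -> int * nat,
    set_bij [set i | (0 < i)%N] [set p | (0 < p.2)%N] e /\
    forall i : nat, (0 < i)%N -> lambda i = cylinder_eigenvalue h (e i).

(* Main.v *)
Require Import Defs.
From mathcomp Require Import all_boot all_order all_algebra.
From mathcomp Require Import all_classical all_reals all_analysis.
From mathcomp Require Import zify ring lra.

Set Implicit Arguments.
Unset Strict Implicit.
Unset Printing Implicit Defensive.

Import Order.TTheory GRing.Theory Num.Theory.
Import numFieldNormedType.Exports.

Local Open Scope classical_set_scope.
Local Open Scope ring_scope.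

(* Put a = (pi / h)^2. For the inequality, represent each pair (m, n) by the
   unit cell [m - 1/2, m + 1/2] x [n - 1, n]. The integral of x^2 + a y^2 over
   the cell is m^2 + 1/12 + a (n^2 - n + 1/3), and over any part of the
   half-plane y >= 0 of area k it is at least its value k^2 / h on the half
   ellipse of area k centred at 0 (bathtub principle). So k distinct
   eigenvalues sum to at least k^2 / h plus the sum of a (n - 1/3) - 1/12. If
   that last sum is negative then, since h <= pi^2 <= 12, more than two thirds
   of the pairs lie in the row n = 1, and the cubic growth of the sum of the
   m^2 over this row is enough. Conversely, the case k = 1 is h <= pi^2.

   The bathtub estimate is made row by row: l cells of the row cost at least
   l^3 / 12 in the x-direction, and the rows of the half ellipse are compared
   with a primitive of cos^4 after putting y = Y sin t. *)

(** * Calculus preliminaries and an upper bound for pi *)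

Lemma le_of_is_derive_ge0 (R : realType) (f df : R -> R) (a b : R) :
  a <= b -> (forall x : R, is_derive x 1 f (df x)) ->
  (forall x, a <= x <= b -> 0 <= df x) -> f a <= f b.
Proof.
move=> ab fdf df_ge0.
have cf : {within `[a, b], continuous f}.
  apply: continuous_subspaceT => x.
  apply/differentiable_continuous/derivable1_diffP.
  exact: (@ex_derive _ _ _ _ _ _ _ (fdf x)).
apply: (@ger0_derive1_ndecr R f a b) => // x xab.
rewrite derive1E (@derive_val _ _ _ _ _ _ _ (fdf x)); apply: df_ge0.
by move: xab; rewrite in_itv /= => /andP[/ltW-> /ltW->].
Qed.

(** This is [x <= tan x] at [x = pi / 6], where the tangent is [1 / sqrt 3]. *)
Lemma sqr_pi_le12 (R : realType) : (pi : R) ^+ 2 <= 12.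
Proof.
have pi_gt0 := pi_gt0 R.
set x : R := pi / 6.
have x_itv : 0 < x < pi / 2 by rewrite /x; apply/andP; split; lra.
have s_gt0 : 0 < sin x by apply: sin_gt0_pihalf.
have c_gt0 : 0 < cos x by apply: cos_gt0_pihalf; lra.
have sE : sin x = 1 / 2.
  have : sin (x *+ 2 + x) = 1.
    by rewrite -(@sin_pihalf R); congr sin; rewrite /x; field.
  rewrite sinD sin_mulr2n cos_mulr2n => h3.
  have h2 := cos2Dsin2 x.
  (* The triple angle formula gives [4 s^3 - 3 s + 1 = 0] for [s = sin x]; the left side factors
     this way. *)
  have : (sin x + 1) * (2 * sin x - 1) ^+ 2 = 0 by nra.
  move/eqP; rewrite mulf_eq0 sqrf_eq0 => /orP[] /eqP; lra.
have tan_ge : 0 <= sin x - x * cos x.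
  have := @le_of_is_derive_ge0 R (fun y => sin y - y * cos y)
    (fun y => y * sin y) 0 x.
  rewrite sin0 mul0r subr0; apply; [lra| |].
    move=> y; apply: is_derive_eq.
    by rewrite /GRing.scale /=; ring.
  move=> y /andP[y_ge0 yx]; apply: mulr_ge0 => //.
  by apply: sin_ge0_pi; rewrite /x in yx; lra.
have h2 := cos2Dsin2 x.
have c2 : cos x ^+ 2 = 3 / 4 by rewrite sE in h2; lra.
have : (x * cos x) ^+ 2 <= (1 / 2) ^+ 2.
  rewrite ler_sqr ?nnegrE; [lra|apply: mulr_ge0|]; lra.
rewrite exprMn c2 /x; lra.
Qed.

(** * The bathtub estimate, one row at a time *)

Definition cos4_primitive (R : realType) (t : R) : R :=
  3 / 8 * t + 3 / 8 * (cos t * sin t) + 1 / 4 * (cos t ^+ 3 * sin t).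

Lemma is_derive_cos4_primitive (R : realType) (t : R) :
  is_derive t 1 (@cos4_primitive R) (cos t ^+ 4).
Proof.
rewrite /cos4_primitive; apply: is_derive_eq.
rewrite /GRing.scale /=; apply/eqP; rewrite -subr_eq0; apply/eqP.
transitivity ((- 3 / 8 - 3 / 4 * cos t ^+ 2) * (cos t ^+ 2 + sin t ^+ 2 - 1)).
  by field.
by rewrite cos2Dsin2 subrr mulr0.
Qed.

Lemma ler_sin (R : realType) :
  {in `[- (pi / 2), pi / 2] &, {mono (@sin R) : x y / x <= y}}.
Proof. by move=> x y xI yI; rewrite !leNgt ltr_sin. Qed.

(* The derivative of the difference of the two sides is
   [cos t * (2 * p * cos t - l) ^ 2 * (4 * p * cos t + l) / 12]. *)
Lemma cos4_primitive_cell (R : realType) (p l t1 t2 : R) :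
  0 <= p -> 0 <= l -> 0 <= t1 -> t1 <= t2 -> t2 <= pi / 2 ->
  l * p ^+ 2 * (sin t2 - sin t1 - (sin t2 ^+ 3 - sin t1 ^+ 3) / 3)
    - l ^+ 3 / 12 * (sin t2 - sin t1)
  <= 4 / 3 * p ^+ 3 * (cos4_primitive t2 - cos4_primitive t1).
Proof.
move=> p_ge0 l_ge0 t1_ge0 t12 t2_le.
pose g t : R := 4 / 3 * p ^+ 3 * cos4_primitive t - l * p ^+ 2 * sin t
  + l * p ^+ 2 / 3 * sin t ^+ 3 + l ^+ 3 / 12 * sin t.
pose dg t : R :=
  cos t * (2 * p * cos t - l) ^+ 2 * (4 * p * cos t + l) / 12.
suff : g t1 <= g t2 by rewrite /g; lra.
apply: (@le_of_is_derive_ge0 _ _ dg) => // t; last first.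
  move=> /andP[t1t tt2].
  have c_ge0 : 0 <= cos t by apply: cos_ge0_pihalf; lra.
  have pc_ge0 : 0 <= p * cos t by apply: mulr_ge0.
  rewrite /dg; apply: divr_ge0 => //; apply: mulr_ge0; last by lra.
  by apply: mulr_ge0 => //; apply: sqr_ge0.
have := is_derive_cos4_primitive t => dJ.
rewrite /g; apply: is_derive_eq.
rewrite /dg /GRing.scale /=; apply/eqP; rewrite -subr_eq0; apply/eqP.
transitivity (l * p ^+ 2 * cos t * (cos t ^+ 2 + sin t ^+ 2 - 1)).
  by field.
by rewrite cos2Dsin2 subrr mulr0.
Qed.

(** The angle at which the line [y = n] meets the ellipse of vertical semi-axis [Y], when
    [y = Y sin t]; capped at [pi / 2] beyond the top. *)
Definition row_angle (R : realType) (Y : R) (n : nat) : R :=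
  asin (Num.min 1 (n%:R / Y)).

Lemma row_angle_itv (R : realType) (Y : R) (n : nat) :
  0 < Y -> 0 <= row_angle Y n <= pi / 2.
Proof.
move=> Y_gt0; rewrite /row_angle; set s := Num.min _ _.
have s_ge0 : 0 <= s by rewrite /s le_min ler01 divr_ge0 // ltW.
have s_le1 : s <= 1 by rewrite /s ge_min lexx.
rewrite asin_lepi2 ?s_le1 ?andbT; last by lra.
have /andP[lo hi] : - (pi / 2) <= asin s <= pi / 2.
  by rewrite asin_lepi2 ?asin_geNpi2 //; lra.
rewrite -ler_sin ?in_itv /= ?lo ?hi //.
  by rewrite sin0 asinK // in_itv /=; lra.
by have := pi_gt0 R; lra.
Qed.

Lemma sin_row_angle (R : realType) (Y : R) (n : nat) :
  0 < Y -> sin (row_angle Y n) = Num.min 1 (n%:R / Y).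
Proof.
move=> Y_gt0; rewrite /row_angle asinK // in_itv /= ge_min lexx andbT.
by apply: (@le_trans _ _ 0); rewrite ?oppr_le0 // le_min ler01 divr_ge0 // ltW.
Qed.

Lemma row_angle_mono (R : realType) (Y : R) (n : nat) :
  0 < Y -> row_angle Y n <= row_angle Y n.+1.
Proof.
move=> Y_gt0.
have /andP[a0 a1] := row_angle_itv n Y_gt0.
have /andP[b0 b1] := row_angle_itv n.+1 Y_gt0.
rewrite -ler_sin ?in_itv /= ?a1 ?b1 ?andbT; [|lra..].
rewrite !sin_row_angle //; apply: le_min2 => //.
by rewrite ler_pM2r ?invr_gt0 // ler_nat.
Qed.

(** Put [f = (al Y)^2 - x^2 - al^2 y^2]. The left side integrates [f] over the centred rectangle of
    width [l] in the strip [n <= y <= n + 1]; the right side integrates the positive part of [f]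
    over the whole strip. *)
Lemma ellipse_row (R : realType) (al Y l : R) (n : nat) :
  0 < al -> 0 < Y -> 0 <= l ->
  l * (al * Y) ^+ 2 - l * al ^+ 2 * (n%:R ^+ 2 + n%:R + 1 / 3) - l ^+ 3 / 12
  <= 4 / 3 * al ^+ 3 * Y ^+ 4 *
     (cos4_primitive (row_angle Y n.+1) - cos4_primitive (row_angle Y n)).
Proof.
move=> al_gt0 Y_gt0 l_ge0.
have /andP[a0 a1] := row_angle_itv n Y_gt0.
have /andP[b0 b1] := row_angle_itv n.+1 Y_gt0.
have ab := row_angle_mono n Y_gt0.
have p_ge0 : 0 <= al * Y by rewrite mulr_ge0 // ltW.
have := cos4_primitive_cell p_ge0 l_ge0 a0 ab b1.
rewrite !sin_row_angle //.
set J := _ - cos4_primitive _.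
have -> : 4 / 3 * al ^+ 3 * Y ^+ 4 * J = Y * (4 / 3 * (al * Y) ^+ 3 * J)
  by ring.
rewrite -(ler_pM2l Y_gt0); apply: le_trans.
have n_ge0 : 0 <= n%:R :> R by [].
set N : R := n%:R in n_ge0 *.
have -> : n.+1%:R = N + 1 :> R by rewrite -natr1.
have l3_ge0 : 0 <= l ^+ 3 by apply: exprn_ge0.
have la_ge0 : 0 <= l * al ^+ 2 by apply: mulr_ge0 => //; apply: sqr_ge0.
(* The strip lies below the top [y = Y], straddles it, or lies above it. In the first case both
   sides agree; in the others the surplus [D] is a sum of nonnegative terms. *)
case: (leP (N + 1) Y) => [le_N1Y|lt_YN1].
  have -> : Num.min 1 (N / Y) = N / Y.
    by apply/min_idPr; rewrite ler_pdivrMr //; lra.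
  have -> : Num.min 1 ((N + 1) / Y) = (N + 1) / Y.
    by apply/min_idPr; rewrite ler_pdivrMr //; lra.
  rewrite le_eqVlt; apply/orP; left; apply/eqP; field.
  by apply: lt0r_neq0.
have -> : Num.min 1 ((N + 1) / Y) = 1.
  by apply/min_idPl; rewrite ler_pdivlMr //; lra.
case: (leP N Y) => [le_NY|lt_YN].
  have -> : Num.min 1 (N / Y) = N / Y.
    by apply/min_idPr; rewrite ler_pdivrMr //; lra.
  rewrite -subr_ge0.
  set D := (X in 0 <= X).
  have -> : D = l * al ^+ 2 * ((N + 1 - Y) ^+ 2 * (N + 1 + 2 * Y) / 3)
              + l ^+ 3 / 12 * (N + 1 - Y).
    by rewrite /D; field; apply: lt0r_neq0.
  apply: addr_ge0; apply: mulr_ge0; [by []| |lra..].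
  by apply: divr_ge0 => //; apply: mulr_ge0; [exact: sqr_ge0|lra].
have -> : Num.min 1 (N / Y) = 1.
  by apply/min_idPl; rewrite ler_pdivlMr //; lra.
rewrite -subr_ge0.
set D := (X in 0 <= X).
have -> : D = l * al ^+ 2 * (N ^+ 2 - Y ^+ 2 + N + 1 / 3) + l ^+ 3 / 12.
  by rewrite /D; field.
apply: addr_ge0; last by lra.
have YN2 : Y ^+ 2 <= N ^+ 2 by rewrite ler_sqr ?nnegrE // ltW.
by apply: mulr_ge0 => //; lra.
Qed.

(** Summing [ellipse_row] at level [z = 2 k / h] bounds [k z] minus the cost by the integral over
    the half ellipse, which is [k^2 / h], while [k z] is twice that. *)
Lemma sum_ellipse_rows (R : realType) (h : R) (l : nat -> R) (N : nat) :
  0 < h -> (forall n, 0 <= l n) ->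
  (\sum_(0 <= n < N) l n) ^+ 2 / h <=
  \sum_(0 <= n < N)
    (l n ^+ 3 / 12 + (pi / h) ^+ 2 * (n%:R ^+ 2 + n%:R + 1 / 3) * l n).
Proof.
move=> h_gt0 l_ge0; set k := \sum_(_ <= _ < _) l _.
have pi_gt0 := pi_gt0 R.
have k_ge0 : 0 <= k by apply: sumr_ge0.
have [k0|k_neq0] := eqVneq k 0.
  rewrite k0 expr0n mul0r; apply: sumr_ge0 => n _.
  apply: addr_ge0; first by apply: divr_ge0; rewrite ?exprn_ge0.
  apply: mulr_ge0 => //; apply: mulr_ge0; first exact: sqr_ge0.
  by have : 0 <= n%:R :> R by []; nra.
have k_gt0 : 0 < k by rewrite lt_def k_neq0.
set al := pi / h.
have al_gt0 : 0 < al by rewrite divr_gt0.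
(* The half ellipse [x ^ 2 + (al * y) ^ 2 <= 2 * k / h] has area [k]. *)
set z : R := 2 * k / h.
have z_gt0 : 0 < z by rewrite divr_gt0 // mulr_gt0.
set Y : R := Num.sqrt z / al.
have Y_gt0 : 0 < Y by rewrite divr_gt0 // sqrtr_gt0.
have zE : (al * Y) ^+ 2 = z.
  by rewrite /Y mulrC divfK ?gt_eqF // sqr_sqrtr // ltW.
set C : R := 4 / 3 * al ^+ 3 * Y ^+ 4.
have C_gt0 : 0 < C by rewrite /C mulr_gt0 ?exprn_gt0 // mulr_gt0 ?exprn_gt0 //;
  lra.
pose J n : R := cos4_primitive (row_angle Y n).
have JN_le : J N <= 3 / 16 * pi.
  have /andP[a0 a1] := row_angle_itv N Y_gt0.
  (* With [p = 1] and [l = 0] the cell estimate says that the primitive is nondecreasing. *)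
  have := cos4_primitive_cell ler01 (lexx 0) a0 a1 (lexx _).
  have -> : cos4_primitive (pi / 2) = 3 / 16 * pi :> R.
    by rewrite /cos4_primitive cos_pihalf; field.
  by rewrite /J; lra.
have J0 : J 0 = 0.
  have asin0 : asin 0 = 0 :> R.
    by rewrite -{1}(@sin0 R) sinK // in_itv /=; lra.
  rewrite /J /row_angle mul0r (min_idPr _) // asin0 /cos4_primitive sin0.
  by rewrite !mulr0 !addr0.
have : \sum_(0 <= n < N) (l n * z - (l n ^+ 3 / 12
           + al ^+ 2 * (n%:R ^+ 2 + n%:R + 1 / 3) * l n))
       <= \sum_(0 <= n < N) C * (J n.+1 - J n).
  apply: ler_sum_nat => n _.
  have := @ellipse_row R al Y (l n) n al_gt0 Y_gt0 (l_ge0 n).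
  rewrite zE -/C -/(J n) -/(J n.+1); lra.
rewrite -mulr_sumr telescope_sumr // J0 subr0 big_split /= sumrN -mulr_suml -/k.
have : C * J N <= C * (3 / 16 * pi) by rewrite ler_pM2l.
have -> : C * (3 / 16 * pi) = k ^+ 2 / h.
  have -> : C * (3 / 16 * pi) = (al * Y) ^+ 2 * (al * Y) ^+ 2 * pi / (4 * al).
    by rewrite /C; field; apply: lt0r_neq0.
  rewrite zE /z /al; move: (pi : R) pi_gt0 => p p_gt0.
  by field; rewrite !lt0r_neq0.
have kzE : k * z = 2 * (k ^+ 2 / h) by rewrite /z; ring.
by move=> CJN le_CJN; lra.
Qed.

(** * From real row lengths to integer row sizes *)

Lemma three_sqr_le_cube (l k : nat) :
  (2 * k < 3 * l)%N -> (0 < k)%N ->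
  3 * (k%:R ^+ 2 - k%:R) <= 2 * (l%:R ^+ 3 - l%:R) :> int.
Proof.
move=> kl k_gt0.
have [l_le1|l_gt1] := leqP l 1.
  have -> : l = 1%N by lia.
  have -> : k = 1%N by lia.
  by [].
have : 2 * k%:R <= 3 * l%:R - 1 :> int by lia.
have : 2 <= l%:R :> int by lia.
have : 1 <= k%:R :> int by lia.
set K : int := k%:R; set L : int := l%:R => K1 L2 KL.
(* Insert [2 K <= 3 L - 1] into [2 K (2 K - 2)]. *)
have KK : 4 * (K ^+ 2 - K) <= (3 * L - 1) * (3 * L - 3).
  have : 0 <= (3 * L - 1 - 2 * K) * (3 * L - 3 + 2 * K).
    by apply: mulr_ge0; lia.
  lia.
(* The expanded product is [8 (L^3 - L) - 3 (3 L - 1) (3 L - 3)]. *)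
have LL : 0 <= (L - 1) * ((L - 2) * (8 * L - 3) + 3).
  by apply: mulr_ge0; [lia|apply: addr_ge0 => //; apply: mulr_ge0; lia].
lia.
Qed.

Lemma rows_lower_bound (R : realType) (h : R) (l : nat -> nat) (N : nat) :
  0 < h -> h <= pi ^+ 2 ->
  (\sum_(0 <= n < N) l n)%N%:R ^+ 2 / h <=
  \sum_(0 <= n < N) (((l n)%:R ^+ 3 - (l n)%:R) / 12
    + (pi / h) ^+ 2 * (n.+1%:R ^+ 2) * (l n)%:R) :> R.
Proof.
move=> h_gt0 h_le.
have pi_gt0 := pi_gt0 R.
set a := (pi / h) ^+ 2.
have a_gt0 : 0 < a by rewrite exprn_gt0 // divr_gt0.
set k := (\sum_(_ <= _ < _) l _)%N.
have kE : k%:R = \sum_(0 <= n < N) (l n)%:R :> R by rewrite natr_sum.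
(* Rows are numbered from 0 here, so at most [d] pairs lie outside the first row. *)
pose d := (\sum_(0 <= n < N) n * l n)%N.
have dE : d%:R = \sum_(0 <= n < N) n%:R * (l n)%:R :> R.
  by rewrite natr_sum; apply: eq_bigr => n _; rewrite natrM.
(* Compared with [sum_ellipse_rows], a pair in row [n] gains [a (n + 2/3) - 1/12]; the split is on
   the sign of the total gain. *)
have [far|near] := lerP (k%:R / 12) (a * (d%:R + 2 / 3 * k%:R)).
  have := @sum_ellipse_rows R h (fun n => (l n)%:R) N h_gt0
    (fun n => ler0n R _).
  rewrite -kE -/a => /le_trans; apply.
  rewrite -subr_ge0 -sumrB.
  rewrite (eq_bigr (fun n => a * (n%:R * (l n)%:R)
     + (2 / 3 * a - 1 / 12) * (l n)%:R)); last first.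
    by move=> n _; rewrite -natr1; field.
  rewrite big_split /= -!mulr_sumr -kE -dE; lra.
have k_gt0 : (0 < k)%N.
  rewrite lt0n; apply/eqP => k0; move: near; rewrite k0 mul0r mulr0 addr0.
  by rewrite ltNge mulr_ge0 // ltW.
have kR_gt0 : 0 < k%:R :> R by rewrite ltr0n.
have hV_le : 1 / h <= a.
  rewrite /a expr_div_n ler_pdivlMr ?exprn_gt0 //.
  by rewrite div1r expr2 mulKf ?gt_eqF.
have a_ge : 1 <= 12 * a.
  have : 12^-1 <= h^-1.
    by rewrite lef_pV2 ?posrE // (le_trans h_le) ?sqr_pi_le12.
  by lra.
have a_le : 8 * a <= 1.
  have : 0 <= a * d%:R by rewrite mulr_ge0 // ltW.
  by nra.
(* From [near] and [1/12 <= a]: [a (d + 2/3 k) < k / 12 <= a k]. *)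
have d_small : 3 * d%:R < k%:R :> R.
  have : 0 <= d%:R :> R by [].
  by nra.
have N_gt0 : (0 < N)%N.
  by move: k_gt0; rewrite /k; case: (N) => //; rewrite big_geq.
have k_le : (k <= l 0%N + d)%N.
  rewrite /k /d !(big_ltn N_gt0) mul0n add0n leq_add2l.
  rewrite big_nat_cond [X in (_ <= X)%N]big_nat_cond.
  by apply: leq_sum => n /andP[/andP[n_gt0 _] _]; rewrite leq_pmull.
have kl : (2 * k < 3 * l 0%N)%N.
  have : (3 * d < k)%N by rewrite -(ltr_nat R) natrM.
  by lia.
have cube : 3 * (k%:R ^+ 2 - k%:R) <= 2 * ((l 0%N)%:R ^+ 3 - (l 0%N)%:R) :> R.
  have := three_sqr_le_cube kl k_gt0; rewrite -(ler_int R).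
  by rewrite !rmorphM !rmorphB !rmorphXn /= !rmorph_nat.
have cube_ge0 m : 0 <= m%:R ^+ 3 - m%:R :> R.
  rewrite subr_ge0; case: m => [|m]; first by rewrite expr0n.
  by rewrite ler_eXnr // ler1n.
(* Keep the cubic term of the first row only and replace each squared row number by 1. Then
   [a k^2 = a k + a (k^2 - k)], and [a <= 1/8] lets [cube] absorb the last term. *)
apply: (@le_trans _ _ (((l 0%N)%:R ^+ 3 - (l 0%N)%:R) / 12 + a * k%:R)).
  have : k%:R ^+ 2 / h <= a * k%:R ^+ 2.
    by rewrite mulrC ler_pM2r ?exprn_gt0 // -div1r.
  have : a * (k%:R ^+ 2 - k%:R) <= (k%:R ^+ 2 - k%:R) / 8.
    have : 0 <= k%:R ^+ 2 - k%:R :> R.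
      by rewrite subr_ge0 ler_eXnr // ler1n.
    by nra.
  by lra.
rewrite big_split /=; apply: lerD.
  rewrite (big_ltn N_gt0) lerDl; apply: sumr_ge0 => n _.
  by rewrite divr_ge0.
rewrite kE mulr_sumr; apply: ler_sum => n _.
rewrite ler_wpM2r // ler_peMr ?(ltW a_gt0) //.
by rewrite expr_ge1 // ler1n.
Qed.

(** * Sums of squares of distinct integers *)

Lemma sorted_int_gap (s : seq int) (i d : nat) :
  sorted <%R s -> (i + d < size s)%N -> d%:Z <= s`_(i + d) - s`_i.
Proof.
move=> s_sorted; elim: d => [|d IHd] id_lt; first by rewrite addn0 subrr.
have id_lt' : (i + d < size s)%N by lia.
have := IHd id_lt'.
have : s`_(i + d) < s`_(i + d.+1).
  by apply: (sorted_ltn_nth lt_trans 0 s_sorted); rewrite ?inE // addnS.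
by move: s`_(i + d.+1) s`_(i + d) s`_i => x y z; lia.
Qed.

Lemma sum_sqr_arith (l : nat) :
  \sum_(i < l) (l%:Z - 1 - 2 * i%:Z) ^+ 2 * 3 = l%:Z ^+ 3 - l%:Z.
Proof.
(* The centre must stay fixed while [l] grows in the induction, hence a free [c]. *)
suff sumE (c : int) : \sum_(i < l) (c - 2 * i%:Z) ^+ 2 * 3 =
    l%:Z * (3 * c ^+ 2 - 6 * c * (l%:Z - 1)
            + 2 * (l%:Z - 1) * (2 * l%:Z - 1)).
  by rewrite sumE; ring.
elim: l => [|l IHl]; first by rewrite big_ord0 mul0r.
by rewrite big_ord_recr /= IHl intS; ring.
Qed.

(* Pair the i-th smallest element with the i-th largest one: they differ by
   at least [|l - 1 - 2 * i|], and [2 * (x ^ 2 + y ^ 2) >= (x - y) ^ 2]. *)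
Lemma sum_sqr_uniq_int (T : seq int) :
  uniq T -> (size T)%:Z ^+ 3 - (size T)%:Z <= 12 * \sum_(m <- T) m ^+ 2.
Proof.
move=> T_uniq; set s : seq int := sort <=%R T.
have s_sorted : sorted <%R s by rewrite sort_lt_sorted.
have szE : size T = size s by rewrite size_sort.
have -> : \sum_(m <- T) m ^+ 2 = \sum_(m <- s) m ^+ 2.
  by apply: perm_big; rewrite perm_sym perm_sort.
rewrite szE -sum_sqr_arith -mulr_suml (big_nth 0) big_mkord.
set S : int := \sum_(i < size s) s`_i ^+ 2.
have SE : S = \sum_(i < size s) s`_(rev_ord i) ^+ 2.
  by rewrite /S (reindex_inj rev_ord_inj).
set W : int := \sum_(i < size s) _ ^+ 2.
suff : W <= 4 * S by move: (W) (S) => w t; lia.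
have -> : 4 * S = \sum_(i < size s) (2 * (s`_i ^+ 2 + s`_(rev_ord i) ^+ 2)).
  by rewrite -mulr_sumr big_split /= -SE -/S; ring.
apply: ler_sum => i _.
have -> : rev_ord i = (size s - i.+1)%N :> nat by [].
have i_lt := ltn_ord i.
set x : int := s`_i; set y : int := s`_(_ - _).
have gap : `|(size s)%:Z - 1 - 2 * i%:Z| <= `|x - y|.
  have [le_ij|lt_ji] := leqP i (size s - i.+1).
    have := @sorted_int_gap s i (size s - i.+1 - i) s_sorted.
    by rewrite subnKC // -/x -/y; lia.
  have := @sorted_int_gap s (size s - i.+1) (i - (size s - i.+1)) s_sorted.
  by rewrite subnKC ?(ltnW lt_ji) // -/x -/y; lia.
have : ((size s)%:Z - 1 - 2 * i%:Z) ^+ 2 <= (x - y) ^+ 2.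
  by rewrite -[leLHS]real_normK ?num_real // -[leRHS]real_normK ?num_real //
    ler_sqr.
have := sqr_ge0 (x + y); lia.
Qed.

(** * Grouping eigenvalues by rows, and the equivalence *)

Lemma sum_by_rows (V : nmodType) (L : seq (int * nat)) (F : int * nat -> V)
    (N : nat) :
  {in L, forall p, (0 < p.2 <= N)%N} ->
  \sum_(p <- L) F p = \sum_(0 <= n < N) \sum_(p <- L | p.2 == n.+1) F p.
Proof.
move=> L_le; rewrite (exchange_big_dep predT) //=; apply: eq_big_seq => -[m n].
move=> /L_le /=; case: n => // n n_lt.
under eq_bigl do rewrite eqSS eq_sym.
by rewrite big_nat1_eq leq0n n_lt.
Qed.

(** Within a row the first coordinates are distinct, so [sum_sqr_uniq_int] reduces the bound to the
    row sizes. *)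
Lemma sum_eigenvalues_ge (R : realType) (h : R) (L : seq (int * nat)) :
  0 < h -> h <= pi ^+ 2 -> uniq L -> {in L, forall p, (0 < p.2)%N} ->
  (size L)%:R ^+ 2 / h <= \sum_(p <- L) cylinder_eigenvalue h p.
Proof.
move=> h_gt0 h_le L_uniq L_gt0.
pose N := (\max_(p <- L) p.2)%N.
have L_le : {in L, forall p, (0 < p.2 <= N)%N}.
  by move=> p pL; rewrite L_gt0 //=; apply: leq_bigmax_seq.
pose row n := [seq p.1 | p <- L & p.2 == n.+1].
have row_uniq n : uniq (row n).
  rewrite map_inj_in_uniq ?filter_uniq // => -[m i] [m' i'].
  by rewrite !mem_filter /= => /andP[/eqP-> _] /andP[/eqP-> _] ->.
have -> : size L = (\sum_(0 <= n < N) size (row n))%N.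
  rewrite -sum1_size (sum_by_rows _ L_le); apply: eq_bigr => n _.
  by rewrite size_map size_filter sum1_count.
rewrite (sum_by_rows _ L_le).
apply: le_trans (rows_lower_bound _ _ h_gt0 h_le) _.
apply: ler_sum => n _.
have -> : \sum_(p <- L | p.2 == n.+1) cylinder_eigenvalue h p =
    \sum_(m <- row n) (m%:~R ^+ 2 + (pi / h) ^+ 2 * n.+1%:R ^+ 2).
  rewrite big_map big_filter; apply: eq_bigr => p /eqP pn.
  by rewrite /cylinder_eigenvalue pn expr_div_n; ring.
rewrite big_split /= big_const_seq count_predT iter_addr_0 mulr_natr lerD2r.
have := sum_sqr_uniq_int (row_uniq n); rewrite -(ler_int R).
rewrite rmorphB rmorphXn rmorphM rmorph_sum /=.
under eq_bigr do rewrite rmorphXn /=.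
by rewrite ler_pdivrMr // mulrC.
Qed.

Theorem corollary3 (R : realType) (h : R) (lambda : nat -> R)
    (h_gt0 : 0 < h) (lambda_spec : dirichlet_spectrum h lambda) :
  (forall k : nat, (0 < k)%N ->
     k%:R^-1 * (\sum_(1 <= i < k.+1) lambda i) >= k%:R / h)
  <-> h \in `]0, pi ^+ 2].
Proof.
have [lambda_mono [e [[e_gt0 e_inj e_surj] lambdaE]]] := lambda_spec.
rewrite in_itv /= h_gt0 /=; split=> [all_k|h_le k k_gt0].
  (* The pair [(0, 1)] has eigenvalue [pi^2 / h^2], at least [lambda 1]; the case [k = 1] then reads
     [1 / h <= pi^2 / h^2]. *)
  have [j j_gt0 ej] := e_surj (0, 1%N) isT.
  have := all_k 1%N isT; rewrite big_nat1 invr1 !mul1r.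
  move=> /le_trans /(_ (lambda_mono 1%N j isT j_gt0)).
  rewrite lambdaE // ej /cylinder_eigenvalue /= expr0n /= add0r expr1n mul1r.
  by rewrite ler_pdivlMr ?exprn_gt0 // expr2 mulKf ?gt_eqF.
pose L := [seq e i | i <- index_iota 1 k.+1].
have L_uniq : uniq L.
  rewrite map_inj_in_uniq ?iota_uniq // => i j.
  rewrite !mem_index_iota => /andP[i_gt0 _] /andP[j_gt0 _].
  by apply: e_inj; rewrite inE.
have L_gt0 : {in L, forall p, (0 < p.2)%N}.
  move=> p /mapP[i]; rewrite mem_index_iota => /andP[i_gt0 _] ->.
  exact: e_gt0.
have := sum_eigenvalues_ge h_gt0 h_le L_uniq L_gt0.
rewrite size_map size_iota subn1 /= big_map.
rewrite -(eq_big_nat _ _ (F1 := lambda)); last first.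
  by move=> i /andP[i_gt0 _]; rewrite lambdaE.
have kR_gt0 : 0 < k%:R :> R by rewrite ltr0n.
by rewrite ler_pdivlMl // mulrA -expr2.
Qed.
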